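(* Let $N\ge 3$ and $\mathbf d\in\mathbb R^N$. For $\lambda>0$ let $\mathbf x_1(\lambda)=(\mathbf I_N+\lambda\mathbf D^\top\mathbf D)^{-1}\mathbf d$, and let $\mathbf x_2=\mathbf\Pi(\mathbf\Pi^\top\mathbf\Pi)^{-1}\mathbf\Pi^\top\mathbf d$ be the orthogonal projection of $\mathbf d$ onto the column space of $\mathbf\Pi$. Then $$\lim_{\lambda\to\infty}D_\lambda\big(\mathbf x_1(\lambda)\,\big\|\,\mathbf x_2\big)=0 .$$ Moreover, $\|\mathbf x_1(\lambda)-\mathbf x_2\|_2\to 0$ as $\lambda\to\infty$.
   Context: $\mathbf D\in\mathbb R^{(N-2)\times N}$ is the second-difference matrix, $(\mathbf D\mathbf x)_i=x_i-2x_{i+1}+x_{i+2}$ for $i=1,\dots,N-2$. $\mathbf\Pi=\big(\mathbf 1_N\mid(1,2,\dots,N)^\top\big)\in\mathbb R^{N\times 2}$. $f_\lambda(\mathbf x)=\|\mathbf d-\mathbf x\|_2^2+\lambda\|\mathbf D\mathbf x\|_2^2$ for $\mathbf x\in\mathbb R^N$, and its Bregman divergence is $D_\lambda(\mathbf y_1\|\mathbf y_2):=f_\lambda(\mathbf y_1)-f_\lambda(\mathbf y_2)-\nabla f_\lambda(\mathbf y_2)^\top(\mathbf y_1-\mathbf y_2)$. *)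

(* Defs.v *)
From mathcomp Require Import all_boot all_order all_algebra.
From mathcomp Require Import all_classical all_reals all_analysis.
From mathcomp Require Import ring.

Set Implicit Arguments.
Unset Strict Implicit.
Unset Printing Implicit Defensive.

Import Order.TTheory GRing.Theory Num.Theory.
Import numFieldNormedType.Exports.

Local Open Scope ring_scope.
Local Open Scope classical_set_scope.

(* The library norm `|x| on matrices is the sup norm, hence this definition. *)
Definition norm2 (R : realType) (n : nat) (x : 'cV[R]_n) : R :=
  Num.sqrt (\sum_(i < n) x i 0 ^+ 2).

Definition gradient (R : realType) (n : nat) (f : 'cV[R]_n -> R)
    (x : 'cV[R]_n) : 'cV[R]_n :=
  \col_(i < n) 'D_(delta_mx i 0) f x.

Definition bregman (R : realType) (n : nat) (f : 'cV[R]_n -> R)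
    (y1 y2 : 'cV[R]_n) : R :=
  f y1 - f y2 - ((gradient f y2)^T *m (y1 - y2)) 0 0.

Definition second_diff (R : realType) (N : nat) : 'M[R]_(N - 2, N) :=
  \matrix_(i < N - 2, j < N)
    ((j == i :> nat)%:R - 2 * (j == i.+1 :> nat)%:R + (j == i.+2 :> nat)%:R).

(* Row index i : 'I_N stands for i + 1, so the second column is (1, ..., N)^T. *)
Definition affine_basis (R : realType) (N : nat) : 'M[R]_(N, 1 + 1) :=
  row_mx (const_mx 1) (\col_(i < N) i.+1%:R).

Definition objective (R : realType) (N : nat) (d : 'cV[R]_N) (lambda : R)
    (x : 'cV[R]_N) : R :=
  norm2 (d - x) ^+ 2 + lambda * norm2 (second_diff R N *m x) ^+ 2.

(* invmx A is A itself when A is singular; system_unit and gram_unit below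
   show that only genuine inverses occur in x1 and x2. *)
Definition x1 (R : realType) (N : nat) (d : 'cV[R]_N) (lambda : R) : 'cV[R]_N :=
  invmx (1%:M + lambda *: ((second_diff R N)^T *m second_diff R N)) *m d.

Definition x2 (R : realType) (N : nat) (d : 'cV[R]_N) : 'cV[R]_N :=
  let P := affine_basis R N in P *m invmx (P^T *m P) *m P^T *m d.

Section Sanity.
Variable R : realType.

Lemma second_diffE N (x : 'cV[R]_N) (i : 'I_(N - 2)) (j0 j1 j2 : 'I_N) :
  j0 = i :> nat -> j1 = i.+1 :> nat -> j2 = i.+2 :> nat ->
  (second_diff R N *m x) i 0 = x j0 0 - 2 * x j1 0 + x j2 0.
Proof.
move=> e0 e1 e2; rewrite mxE.
have pick (k : 'I_N) (m : nat) : k = m :> nat ->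
    \sum_(j < N) (j == m :> nat)%:R * x j 0 = x k 0.
  move=> <-; rewrite (bigD1 k) //= eqxx mul1r big1 ?addr0 // => j njk.
  by rewrite (_ : (j == k :> nat) = false) ?mul0r //; apply: negbTE.
rewrite -(pick _ _ e0) -(pick _ _ e1) -(pick _ _ e2) mulr_sumr -sumrB -big_split.
by apply: eq_bigr => j _ /=; rewrite mxE; ring.
Qed.

Lemma mulmx_tr_ge0 n (v : 'rV[R]_n) : 0 <= (v *m v^T) 0 0.
Proof. by rewrite mxE; apply: sumr_ge0 => i _; rewrite mxE -expr2 sqr_ge0. Qed.

Lemma mulmx_tr_eq0 n (v : 'rV[R]_n) : (v *m v^T) 0 0 = 0 -> v = 0.
Proof.
rewrite mxE => /eqP; rewrite psumr_eq0 => [/allP v0|i _]; last first.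
  by rewrite mxE -expr2 sqr_ge0.
apply/rowP => i; rewrite mxE; apply/eqP.
by have := v0 i (mem_index_enum _); rewrite mxE -expr2 sqrf_eq0.
Qed.

Lemma system_unit N (lambda : R) : 0 < lambda ->
  1%:M + lambda *: ((second_diff R N)^T *m second_diff R N) \in unitmx.
Proof.
move=> l0; rewrite -row_free_unit; apply: inj_row_free => v vA0.
have : ((v *m (1%:M + lambda *: ((second_diff R N)^T *m second_diff R N)))
        *m v^T) 0 0 = 0 by rewrite vA0 mul0mx mxE.
set w := v *m (second_diff R N)^T.
have -> : (v *m (1%:M + lambda *: ((second_diff R N)^T *m second_diff R N)))
    *m v^T = v *m v^T + lambda *: (w *m w^T).
  by rewrite mulmxDr mulmx1 mulmxDl -scalemxAr -scalemxAl trmx_mul trmxK !mulmxA.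
rewrite mxE [X in _ + X]mxE => /eqP.
rewrite paddr_eq0 ?mulr_ge0 ?(ltW l0) ?mulmx_tr_ge0 // => /andP[/eqP + _].
exact: mulmx_tr_eq0.
Qed.

Lemma gram_unit N : (2 <= N)%N ->
  (affine_basis R N)^T *m affine_basis R N \in unitmx.
Proof.
move=> N2; set P := affine_basis R N.
rewrite -row_free_unit; apply: inj_row_free => v vA0.
have vP0 : v *m P^T = 0.
  apply: mulmx_tr_eq0.
  by rewrite trmx_mul trmxK !mulmxA -(mulmxA v) vA0 mul0mx mxE.
have entry (i : 'I_N) : v 0 (lshift 1 0) + v 0 (rshift 1 0) * i.+1%:R = 0.
  have := congr1 (fun u : 'rV[R]_N => u 0 i) vP0.
  rewrite mxE [RHS]mxE big_split_ord !big_ord1 ![P^T _ _]mxE => <-.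
  by rewrite /P row_mxEl row_mxEr !mxE mulr1.
have e0 := entry (Ordinal (ltnW N2)); have e1 := entry (Ordinal N2).
have v1 : v 0 (rshift 1 0) = 0.
  rewrite -[LHS](_ : (v 0 (lshift 1 0) + v 0 (rshift 1 0) * 2%:R)
    - (v 0 (lshift 1 0) + v 0 (rshift 1 0) * 1%:R) = _); last by ring.
  by rewrite e0 e1 subrr.
move: e0; rewrite v1 mul0r addr0 => v0.
apply/rowP => j; rewrite [RHS]mxE -[j]splitK.
by case: (fintype.split j) => k /=; rewrite ord1.
Qed.

Lemma x2_range N (d : 'cV[R]_N) : exists c, x2 d = affine_basis R N *m c.
Proof. by eexists; rewrite /x2 -!mulmxA. Qed.

Lemma x2_orthogonal N (d : 'cV[R]_N) : (2 <= N)%N ->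
  (affine_basis R N)^T *m (d - x2 d) = 0.
Proof.
by move=> N2; rewrite mulmxBr /x2 !mulmxA mulmxV ?gram_unit// mul1mx subrr.
Qed.

End Sanity.

(* Main.v *)
Require Import Defs.
From mathcomp Require Import all_boot all_order all_algebra.
From mathcomp Require Import all_classical all_reals all_analysis.
From mathcomp Require Import ring lra.

Import Order.TTheory GRing.Theory Num.Theory.
Import numFieldNormedType.Exports.

Local Open Scope ring_scope.
Local Open Scope classical_set_scope.

(** Write [z = x1 - x2] and [r = d - x2]. Since [D x2 = 0], subtracting the
    linear systems gives [(I + lambda D^T D) z = r]. The kernel of [D] is the
    column space of [Pi] and [r] is orthogonal to it, so [r = D^T w] for some
    [w] independent of [lambda]. As [f_lambda] is quadratic, the Bregman
    divergence is [B = |z|^2 + lambda |D z|^2 = <z, r> = <D z, w>], and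
    [<D z, w> <= lambda |D z|^2 / 2 + |w|^2 / (2 lambda)] yields
    [|z|^2 <= B <= |w|^2 / lambda]. *)

Lemma scalemxE (R : pzRingType) m n (a : R) (A : 'M[R]_(m, n)) i j :
  (a *: A) i j = a * A i j.
Proof. by rewrite mxE. Qed.

Lemma norm2_ge0 (R : realType) n (x : 'cV[R]_n) : 0 <= norm2 x.
Proof. exact: sqrtr_ge0. Qed.

Lemma norm2_sqr (R : realType) n (x : 'cV[R]_n) :
  norm2 x ^+ 2 = (x^T *m x) 0 0.
Proof.
rewrite sqr_sqrtr; last by apply: sumr_ge0 => i _; exact: sqr_ge0.
by rewrite mxE; apply: eq_bigr => i _; rewrite mxE expr2.
Qed.

Lemma dotmxC (R : realType) n (x y : 'cV[R]_n) :
  (x^T *m y) 0 0 = (y^T *m x) 0 0.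
Proof. by rewrite -[y in LHS]trmxK -trmx_mul mxE. Qed.

Lemma norm2_sqrD (R : realType) n (x y : 'cV[R]_n) :
  norm2 (x + y) ^+ 2 = norm2 x ^+ 2 + 2 * (x^T *m y) 0 0 + norm2 y ^+ 2.
Proof.
rewrite !norm2_sqr [(x + y)^T]linearD /= mulmxDl !mulmxDr !mxE.
have := dotmxC _ _ y x; rewrite !mxE => ->; ring.
Qed.

Lemma norm2_sqrZ (R : realType) n (a : R) (x : 'cV[R]_n) :
  norm2 (a *: x) ^+ 2 = a ^+ 2 * norm2 x ^+ 2.
Proof.
by rewrite !norm2_sqr [(a *: x)^T]linearZ /= -scalemxAl -scalemxAr !mxE mulrA expr2.
Qed.

(** Young's inequality with weight [a]: expand [0 <= |a x - y|^2] and divide by [a]. *)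
Lemma dotmx_le (R : realType) n (x y : 'cV[R]_n) (a : R) : 0 < a ->
  2 * (x^T *m y) 0 0 <= a * norm2 x ^+ 2 + norm2 y ^+ 2 / a.
Proof.
move=> a0; have := sqr_ge0 (norm2 (a *: x + (- 1) *: y)).
rewrite norm2_sqrD !norm2_sqrZ [(a *: x)^T]linearZ /= -scalemxAl -scalemxAr.
rewrite !scalemxE => h.
rewrite -(ler_pM2l a0) mulrDr [X in _ <= _ + X]mulrC divfK ?gt_eqF //.
by nra.
Qed.

(** For [h != 0] the difference quotient along [v] is exactly [b + h * q]. *)
Lemma derive_quadratic (R : realType) n (f : 'cV[R]_n -> R) x v (b q : R) :
  (forall h : R, f (x + h *: v) = f x + h * b + h ^+ 2 * q) ->
  'D_v f x = b.
Proof.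
move=> fE; apply: cvg_lim => //.
have : (b + h * q) @[h --> (0 : R)^'] --> b + 0 * q.
  apply: cvgD; first exact: cvg_cst.
  apply: cvgM; last exact: cvg_cst.
  exact: (cvg_trans (@nbhs_dnbhs _ _) cvg_id).
rewrite mul0r addr0; apply: cvg_trans; apply: near_eq_cvg.
near=> h; have h0 : h != 0 by near: h; exact: nbhs_dnbhs_neq.
rewrite /= [h *: v + x]addrC fE /GRing.scale /=.
by field.
Unshelve. all: by end_near. Qed.

(** Exact second-order Taylor expansion: the part linear in [u] yields the gradient, the quadratic
    remainder is the Bregman divergence. *)
Lemma objectiveD (R : realType) N (d : 'cV[R]_N) (lambda : R) (x u : 'cV[R]_N) :
  let D := second_diff R N in
  objective d lambda (x + u) = objective d lambda x
    + 2 * ((x - d + lambda *: (D^T *m (D *m x)))^T *m u) 0 0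
    + (norm2 u ^+ 2 + lambda * norm2 (D *m u) ^+ 2).
Proof.
move=> D; rewrite /objective -/D.
have sqrN (y : 'cV[R]_N) : norm2 y ^+ 2 = norm2 (- y) ^+ 2.
  by rewrite -scaleN1r norm2_sqrZ sqrrN expr1n mul1r.
rewrite sqrN [norm2 (d - x) ^+ 2]sqrN !opprB addrAC mulmxDr.
rewrite (norm2_sqrD _ _ (x - d)) (norm2_sqrD _ _ (D *m x)).
rewrite [(_ + lambda *: _)^T]linearD linearZ /= [(D^T *m _)^T]trmx_mul trmxK.
rewrite mulmxDl -scalemxAl -mulmxA [((x - d)^T *m u + _) 0 0]mxE scalemxE.
ring.
Qed.

Lemma gradient_objective (R : realType) N (d : 'cV[R]_N) (lambda : R)
    (x : 'cV[R]_N) :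
  let D := second_diff R N in
  gradient (objective d lambda) x
    = 2 *: (x - d + lambda *: (D^T *m (D *m x))).
Proof.
move=> D; apply/colP => i; rewrite mxE.
set g := x - d + _.
rewrite (@derive_quadratic _ _ _ _ _ ((2 *: g) i 0)
  (norm2 (delta_mx i 0 : 'cV[R]_N) ^+ 2
   + lambda * norm2 (D *m (delta_mx i 0 : 'cV[R]_N)) ^+ 2)) // => h.
rewrite objectiveD -/D -/g -!scalemxAr !norm2_sqrZ.
rewrite -[g^T *m _]colE !scalemxE [col i g^T 0 0]mxE [g^T 0 i]mxE.
ring.
Qed.

Lemma bregman_objective (R : realType) N (d : 'cV[R]_N) (lambda : R)
    (y1 y2 : 'cV[R]_N) :
  bregman (objective d lambda) y1 y2
    = norm2 (y1 - y2) ^+ 2 + lambda * norm2 (second_diff R N *m (y1 - y2)) ^+ 2.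
Proof.
rewrite /bregman gradient_objective.
rewrite -[X in objective _ _ X](subrKC y2) objectiveD.
rewrite [(2 *: _)^T]linearZ -scalemxAl scalemxE.
ring.
Qed.

Lemma second_diff_affine (R : realType) N :
  second_diff R N *m affine_basis R N = 0.
Proof.
apply/matrixP => i j.
have lt2 : (i.+2 < N)%N by have := ltn_ord i; rewrite ltn_subRL addnC addn2.
transitivity ((second_diff R N *m col j (affine_basis R N)) i 0).
  by rewrite !colE mulmxA -colE [RHS]mxE.
rewrite (@second_diffE _ _ _ _ (Ordinal (ltnW (ltnW lt2))) (Ordinal (ltnW lt2))
  (Ordinal lt2)) // !mxE.
case: fintype.splitP => k _; rewrite !mxE /=; first by ring.
by rewrite -!natr1; ring.
Qed.

(** Vanishing second differences are a two-term linear recurrence, so the first two entries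
    determine [v]; strong induction on the index solves it. *)
Lemma second_diff_ker (R : realType) N (v : 'cV[R]_N) : (2 <= N)%N ->
  second_diff R N *m v = 0 -> exists c, v = affine_basis R N *m c.
Proof.
move=> N2 Dv; set i0 := Ordinal (ltnW N2); set i1 := Ordinal N2.
have vE (m : nat) (i : 'I_N) : i = m :> nat ->
    v i 0 = v i0 0 + m%:R * (v i1 0 - v i0 0).
  elim/ltn_ind: m i => -[|[|m]] IH i im.
  - by rewrite mul0r addr0; congr (v _ 0); apply: val_inj.
  - by rewrite mul1r subrKC; congr (v _ 0); apply: val_inj.
  have mN : (m.+2 < N)%N by rewrite -im.
  have mN2 : (m < N - 2)%N by rewrite ltn_subRL addnC addn2.
  have := @second_diffE R N v (Ordinal mN2) (Ordinal (ltnW (ltnW mN)))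
    (Ordinal (ltnW mN)) i erefl erefl im.
  rewrite Dv mxE (IH m _ (Ordinal (ltnW (ltnW mN)))) //.
  rewrite (IH m.+1 _ (Ordinal (ltnW mN))) // => /eqP.
  rewrite eq_sym addrC addr_eq0 => /eqP ->.
  by rewrite -!natr1; ring.
(* Row [i] of the second basis column holds [i + 1], whereas [vE] counts from 0; hence one slope is
   subtracted from the intercept. *)
exists (col_mx (v i0 0 - (v i1 0 - v i0 0))%:M (v i1 0 - v i0 0)%:M).
apply/colP => i; rewrite mul_row_col !mul_mx_scalar !mxE (vE i) // -natr1.
ring.
Qed.

(** The row space of [D] is the orthogonal complement of its kernel. *)
Lemma affine_orthogonal_range (R : realType) N (r : 'cV[R]_N) : (2 <= N)%N ->
  (affine_basis R N)^T *m r = 0 -> exists w, r = (second_diff R N)^T *m w.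
Proof.
move=> N2 Pr.
have /submxP[w rE] : (r^T <= second_diff R N)%MS.
  rewrite submxE; apply/eqP/rowP => j.
  (* Each column of the cokernel matrix [K] is killed by [D], hence lies in the range of
     [affine_basis], to which [r] is orthogonal. *)
  move: (cokermx _) (mulmx_coker (second_diff R N)) => K DK.
  have /(second_diff_ker _ _ _ N2)[c Kc] : second_diff R N *m col j K = 0.
    by rewrite colE mulmxA DK mul0mx.
  transitivity ((r^T *m col j K) 0 0); first by rewrite colE mulmxA -colE [RHS]mxE.
  by rewrite Kc mulmxA -[affine_basis R N]trmxK -trmx_mul Pr trmx0 mul0mx !mxE.
by exists w^T; rewrite -trmx_mul -rE trmxK.
Qed.

Lemma second_diff_x2 (R : realType) N (d : 'cV[R]_N) :
  second_diff R N *m x2 d = 0.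
Proof. by have [c ->] := x2_range d; rewrite mulmxA second_diff_affine mul0mx. Qed.

Lemma bregman_x1_x2_le (R : realType) N (d : 'cV[R]_N) : (2 <= N)%N ->
  exists C : R, forall lambda, 0 < lambda ->
  bregman (objective d lambda) (x1 d lambda) (x2 d) <= C / lambda.
Proof.
move=> N2; have [w rE] := affine_orthogonal_range _ _ _ N2 (x2_orthogonal d N2).
exists (norm2 w ^+ 2) => lambda l0; rewrite bregman_objective.
set D := second_diff R N in rE *; set z := x1 d lambda - x2 d.
(* The system matrix sends [x1] to [d] and fixes [x2], because [D] kills [x2]. *)
have zE : z + lambda *: (D^T *m (D *m z)) = D^T *m w.
  rewrite mulmxA scalemxAl -[X in X + _]mul1mx -mulmxDl mulmxBr.
  rewrite /x1 mulmxA mulmxV ?system_unit // mul1mx -rE; congr (d - _).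
  by rewrite mulmxDl mul1mx -scalemxAl -mulmxA second_diff_x2 mulmx0 scaler0 addr0.
clearbody z.
(* Pair [zE] with [z]. *)
have BE : norm2 z ^+ 2 + lambda * norm2 (D *m z) ^+ 2 = ((D *m z)^T *m w) 0 0.
  rewrite trmx_mul -mulmxA -zE mulmxDr -scalemxAr !norm2_sqr.
  by rewrite trmx_mul !mulmxA [RHS]mxE [X in _ = _ + X]mxE.
(* With [B] the left side of [BE], weight [lambda] gives [2 B <= lambda |D z|^2 + |w|^2 / lambda];
   the first summand is at most [B] and is absorbed. *)
have := dotmx_le _ _ (D *m z) w _ l0; rewrite -BE.
have := sqr_ge0 (norm2 z); lra.
Qed.

Theorem proposition3 (R : realType) (N : nat) (hN : (3 <= N)%N)
    (d : 'cV[R]_N) :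
  (bregman (objective d lambda) (x1 d lambda) (x2 d)
     @[lambda --> +oo%R] --> (0 : R)) /\
  (norm2 (x1 d lambda - x2 d) @[lambda --> +oo%R] --> (0 : R)).
Proof.
have [C BC] := bregman_x1_x2_le _ _ d (ltnW hN).
have C0 : C / lambda @[lambda --> +oo%R] --> (0 : R).
  rewrite -(mulr0 C); apply: cvgM; first exact: cvg_cst.
  by apply/gtr0_cvgV0; [exact: nbhs_pinfty_gt | exact: cvg_id].
have sqr_le (lambda : R) : 0 < lambda -> norm2 (x1 d lambda - x2 d) ^+ 2
    <= bregman (objective d lambda) (x1 d lambda) (x2 d).
  by move=> l0; rewrite bregman_objective lerDl mulr_ge0 ?sqr_ge0 // ltW.
split.
  apply: (squeeze_cvgr _ (cvg_cst 0) C0); near=> l.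
  have l0 : 0 < l by near: l; exact: nbhs_pinfty_gt.
  by rewrite BC // (le_trans (sqr_ge0 _) (sqr_le _ l0)).
have sqrtC0 : Num.sqrt (C / lambda) @[lambda --> +oo%R] --> (0 : R).
  by rewrite -(@sqrtr0 R); apply: continuous_cvg C0; exact: sqrt_continuous.
apply: (squeeze_cvgr _ (cvg_cst 0) sqrtC0); near=> l.
have l0 : 0 < l by near: l; exact: nbhs_pinfty_gt.
(* Rewrite the norm as the root of its square, which the divergence, and so [C / l], dominates. *)
rewrite norm2_ge0 -[leLHS]ger0_norm ?norm2_ge0 // -sqrtr_sqr.
by rewrite ler_wsqrtr // (le_trans (sqr_le _ l0)) ?BC.
Unshelve. all: by end_near. Qed.
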